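(* Let $u,v\in\mathcal{F}(\mathbb{R})$ be fuzzy numbers and let $\alpha\in[0,1]$. Then the following hold. (i) If $u'_-(u^-(\alpha))=\varphi>0$ and $v'_-(v^-(\alpha))=\psi>0$, then $(u\nabla v)'_-((u\nabla v)^-(\alpha))=(\varphi^{-1}+\psi^{-1})^{-1}$. (ii) If $u'_+(u^-(\alpha))=\varphi>0$, $v'_+(v^-(\alpha))=\psi>0$, and $u(u^-(\alpha))=v(v^-(\alpha))=\beta$, then $(u\nabla v)'_+((u\nabla v)^-(\beta))=(\varphi^{-1}+\psi^{-1})^{-1}$. (iii) If $u'_+(u^-(\alpha))=\varphi$, $u(u^-(\alpha))=\beta$, and $v(v^-(\alpha))=\gamma>\beta$, then $(u\nabla v)'_+((u\nabla v)^-(\beta))=\varphi$. (iv) If $u'_-(u^-(\alpha))=\varphi$ and $\lim_{y\to v^-(\alpha)-}v(y)=\lambda<\alpha$, then $(u\nabla v)'_-((u\nabla v)^-(\alpha))=\varphi$.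
   Context: A fuzzy number is a map $u:\mathbb{R}\to[0,1]$ such that, writing $[u]_\alpha=\{x:u(x)\ge\alpha\}$ for $\alpha\in(0,1]$ and $[u]_0=\overline{\{x:u(x)>0\}}$, the set $[u]_1$ is nonempty and each $[u]_\alpha=[u^-(\alpha),u^+(\alpha)]$, $\alpha\in[0,1]$, is a compact interval. $\mathcal{F}(\mathbb{R})$ is the set of all fuzzy numbers. The sup-min convolution is $(u\nabla v)(x)=\sup_{y\in\mathbb{R}}\min\{u(y),v(x-y)\}$; it is a fuzzy number with $[u\nabla v]_\alpha=[u^-(\alpha)+v^-(\alpha),u^+(\alpha)+v^+(\alpha)]$ for all $\alpha\in[0,1]$. $f'_-$ and $f'_+$ denote the (finite) left and right derivatives of a function $f:\mathbb{R}\to\mathbb{R}$. *)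

(* Defs.v *)
From HB Require Import structures.
From mathcomp Require Import all_boot all_order all_algebra.
From mathcomp Require Import all_classical all_reals all_analysis.
Set Implicit Arguments.
Unset Strict Implicit.
Unset Printing Implicit Defensive.
Import Order.TTheory GRing.Theory Num.Theory.
Import numFieldNormedType.Exports.
Local Open Scope classical_set_scope.
Local Open Scope ring_scope.

(* Meant for [0 <= a <= 1]; outside that range the value is irrelevant. *)
Definition level_set (R : realType) (u : R -> R) (a : R) : set R :=
  if a == 0 then closure [set x | 0 < u x] else [set x | a <= u x].

(* The endpoints u^-(a) and u^+(a): the inf and sup of [level_set u a] are
   the actual endpoints as soon as the level set is a nonempty compact
   interval, as it is for a fuzzy number and [0 <= a <= 1]. *)
Definition level_left (R : realType) (u : R -> R) (a : R) : R :=
  inf (level_set u a).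

Definition level_right (R : realType) (u : R -> R) (a : R) : R :=
  sup (level_set u a).

Definition fuzzy_number (R : realType) (u : R -> R) : Prop :=
  [/\ forall x : R, 0 <= u x <= 1,
      level_set u 1 !=set0 &
      forall a : R, 0 <= a <= 1 ->
        level_set u a = `[level_left u a, level_right u a]%classic].

Definition sup_min_conv (R : realType) (u v : R -> R) (x : R) : R :=
  sup [set Num.min (u y) (v (x - y)) | y in [set: R]].

(* [l] is a real number, so these say that the one-sided derivative exists,
   is finite and equals [l]. *)
Definition is_left_derivative (R : realType) (f : R -> R) (x l : R) : Prop :=
  (f (x + h) - f x) / h @[h --> 0^'-] --> l.

Definition is_right_derivative (R : realType) (f : R -> R) (x l : R) : Prop :=
  (f (x + h) - f x) / h @[h --> 0^'+] --> l.

(* Main.v *)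
Require Import Defs.
From HB Require Import structures.
From mathcomp Require Import all_boot all_order all_algebra.
From mathcomp Require Import all_classical all_reals all_analysis.
From mathcomp Require Import ring lra.
Import Order.TTheory GRing.Theory Num.Theory.
Import numFieldNormedType.Exports.
Local Open Scope classical_set_scope.
Local Open Scope ring_scope.

(* Let w = u nabla v. If y + z = x, every splitting x = y' + z' has y' <= y or
   z' <= z, so on the increasing branches
     min (u y) (v z) <= w (y + z) <= max (u y) (v z).
   At the endpoints a, b of the level sets, apply this to a + s h and b + t h
   with s + t = 1 and s phi = t psi = (phi^-1 + psi^-1)^-1: both sides have the
   same one-sided derivative, which is then that of w. In (iii) and
   (iv), u (a + h) lies for small h between the values of v on the left of b
   and v b, and splitting at y = a + h, z = b gives
   w (a + b + h) = u (a + h). *)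

(** * Level sets and the increasing branch of a fuzzy number *)

Lemma fuzzy_ge0 {R : realType} {u : R -> R} (x : R) :
  fuzzy_number u -> 0 <= u x.
Proof. by case=> /(_ x) /andP[]. Qed.

Lemma fuzzy_le1 {R : realType} {u : R -> R} (x : R) :
  fuzzy_number u -> u x <= 1.
Proof. by case=> /(_ x) /andP[]. Qed.

Lemma level_setE {R : realType} {u : R -> R} {a : R} :
  0 < a -> level_set u a = [set x | a <= u x].
Proof. by move=> a0; rewrite /level_set gt_eqF. Qed.

Lemma level_set0E {R : realType} {u : R -> R} :
  level_set u 0 = closure [set x | 0 < u x].
Proof. by rewrite /level_set eqxx. Qed.

Lemma level_setS {R : realType} {u : R -> R} {a b : R} :
  0 <= a -> a <= b -> level_set u b `<=` level_set u a.
Proof.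
rewrite le_eqVlt => /predU1P[<-|a0].
  rewrite le_eqVlt => /predU1P[<-//|b0].
  rewrite level_setE// level_set0E => x /= bx.
  by apply: subset_closure => /=; apply: lt_le_trans bx.
move=> ab; rewrite !level_setE//; last exact: lt_le_trans ab.
by move=> x /=; exact: le_trans.
Qed.

Section fuzzy.
Context {R : realType} {u : R -> R}.
Hypothesis hu : fuzzy_number u.

(** A point of the core lies in every level set, so the interval is nonempty and contains its left
    end. *)
Lemma level_left_in {a : R} : 0 <= a <= 1 -> level_set u a (level_left u a).
Proof.
move=> a01; have [_ [p hp] /(_ a a01) E] := hu.
have : level_set u a p by case/andP: a01 => a0 a1; exact: level_setS hp.
by rewrite E/= !in_itv/= lexx => /andP[? ?]; apply: le_trans; eassumption.
Qed.

Lemma level_left_le {a x : R} :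
  0 <= a <= 1 -> level_set u a x -> level_left u a <= x.
Proof.
by move=> a01; have [_ _ /(_ a a01) ->] := hu; rewrite /= in_itv/= => /andP[].
Qed.

Lemma le_level_left {a b : R} :
  0 <= a -> a <= b -> b <= 1 -> level_left u a <= level_left u b.
Proof.
move=> a0 ab b1; apply: level_left_le; first by rewrite a0 (le_trans ab).
by apply: (level_setS a0 ab); apply: level_left_in; rewrite (le_trans a0).
Qed.

Lemma ge_at_level_left {a : R} : 0 <= a <= 1 -> a <= u (level_left u a).
Proof.
move=> a01; have /andP[] := a01.
rewrite le_eqVlt => /predU1P[<- _|a0 _]; first exact: fuzzy_ge0.
by have := level_left_in a01; rewrite level_setE.
Qed.

Lemma lt_left_of_level {a x : R} :
  0 < a <= 1 -> x < level_left u a -> u x < a.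
Proof.
move=> /andP[a0 a1]; rewrite !ltNge; apply: contra => ax.
by apply: level_left_le; rewrite ?(ltW a0)// level_setE.
Qed.

(** At level 0 the level set is the closure of the support, so [u] vanishes to the left of it and
    only the weak inequality survives. *)
Lemma le_left_of_level {a x : R} :
  0 <= a <= 1 -> x < level_left u a -> u x <= a.
Proof.
move=> /andP[]; rewrite le_eqVlt => /predU1P[<- _|a0 a1]; last first.
  by move=> /lt_left_of_level/ltW -> //; rewrite a0.
rewrite ltNge [u x <= _]leNgt; apply: contra => ux; apply: level_left_le.
  by rewrite lexx ler01.
by rewrite level_set0E; exact: subset_closure.
Qed.

(** If [u y] is positive, the level set at height [u y] is an interval containing [y] and the left
    end of the core, hence also the point [x] between them. *)
Lemma left_branch_mono {y x : R} :
  y <= x -> x <= level_left u 1 -> u y <= u x.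
Proof.
move=> yx xp; have := fuzzy_ge0 y hu.
rewrite le_eqVlt => /predU1P[<-|uy0]; first exact: fuzzy_ge0.
have uy1 : 0 <= u y <= 1 by rewrite ltW// fuzzy_le1.
have h01 : 0 <= (1 : R) <= 1 by rewrite ler01 lexx.
have [_ _ /(_ _ uy1) E] := hu.
have : level_set u (u y) x; last by rewrite level_setE.
have : level_set u (u y) y by rewrite level_setE//=.
have : level_set u (u y) (level_left u 1).
  rewrite level_setE//=; apply: (le_trans _ (ge_at_level_left h01)).
  by case/andP: uy1.
rewrite E/= !in_itv/= => /andP[_ pr] /andP[ly _].
by rewrite (le_trans ly)// (le_trans xp).
Qed.

(** When [u] jumps above [a] at its left endpoint, that endpoint serves all levels from [a] up to
    the value reached. In (ii) and (iii) this turns the endpoints at [beta] into those at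
    [alpha]. *)
Lemma level_left_const {a b : R} :
  0 <= a -> a <= b -> u (level_left u a) >= b ->
  level_left u b = level_left u a.
Proof.
move=> a0 ab bu; have b1 : b <= 1 by rewrite (le_trans bu)// fuzzy_le1.
apply/eqP; rewrite eq_le (le_level_left a0 ab b1) andbT.
have [b0|b0] := ltP 0 b; last first.
  by have -> : b = a by apply/eqP; rewrite eq_le ab (le_trans b0).
by apply: level_left_le; rewrite ?(ltW b0)// level_setE.
Qed.

Lemma lt_level_left1 {a : R} :
  0 <= a <= 1 -> u (level_left u a) < 1 -> level_left u a < level_left u 1.
Proof.
case/andP=> a0 a1 ua1; rewrite lt_neqAle (le_level_left a0 a1 (lexx 1)) andbT.
apply: contraTneq ua1 => ->.
by rewrite -leNgt ge_at_level_left// ler01 lexx.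
Qed.

End fuzzy.

(** * Two-sided bounds on the convolution, and its left endpoints *)

Section convolution.
Context {R : realType} {u v : R -> R}.
Hypotheses (hu : fuzzy_number u) (hv : fuzzy_number v).
Local Notation w := (sup_min_conv u v).

Lemma conv_ge (y z : R) : Num.min (u y) (v z) <= w (y + z).
Proof.
apply: ub_le_sup; last by exists y => //; rewrite addrC addKr.
by exists 1 => _ [t _ <-]; rewrite ge_min (fuzzy_le1 _ hu).
Qed.

Lemma conv_le {y z m : R} : (forall t, t <= y -> u t <= m) ->
  (forall t, t < z -> v t <= m) -> w (y + z) <= m.
Proof.
move=> um vm; apply: ge_sup.
  by exists (Num.min (u 0) (v (y + z - 0))); exists 0.
(* Either [t <= y], or [y + z - t < z]. *)
move=> _ [t _ <-]; rewrite ge_min.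
have [ty|yt] := leP t y; first by rewrite um.
by rewrite vm ?orbT// ltrBlDr addrC ltrD2l.
Qed.

Lemma conv_bounds {y z : R} : y <= level_left u 1 -> z <= level_left v 1 ->
  Num.min (u y) (v z) <= w (y + z) <= Num.max (u y) (v z).
Proof.
move=> yp zq; rewrite conv_ge/=; apply: conv_le => t ht; rewrite le_max.
  by rewrite left_branch_mono.
by rewrite (left_branch_mono hv (ltW ht) zq) orbT.
Qed.

(** [v] is bounded only strictly to the left of [z], which leaves room for a jump of [v] at [z], as
    in (iii) and (iv). *)
Lemma conv_eq {y z : R} : y <= level_left u 1 -> u y <= v z ->
  (forall t, t < z -> v t <= u y) -> w (y + z) = u y.
Proof.
move=> yp uv vu; apply/eqP; rewrite eq_le; apply/andP; split.
  by apply: conv_le => // t ty; exact: left_branch_mono.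
by rewrite -{1}(min_idPl uv) conv_ge.
Qed.

(** The sum of the endpoints is shown to be the least element of the level set of [w]. A point left
    of this sum splits into two points, each at the same distance [e] left of its own endpoint,
    where [u] and [v] are too small. *)
Lemma level_left_conv {a : R} : 0 <= a <= 1 ->
  level_left w a = level_left u a + level_left v a.
Proof.
move=> a01.
suff [hin hlb] : level_set w a (level_left u a + level_left v a) /\
    lbound (level_set w a) (level_left u a + level_left v a).
  apply/eqP; rewrite eq_le; apply/andP; split.
    by apply: ge_inf => //; exists (level_left u a + level_left v a).
  by apply: lb_le_inf => //; exists (level_left u a + level_left v a).
have half x : x < level_left u a + level_left v a ->
    exists2 e, 0 < e & x = (level_left u a - e) + (level_left v a - e).
  move=> xl; exists ((level_left u a + level_left v a - x) / 2).
    by rewrite divr_gt0// subr_gt0.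
  by field.
have /andP[] := a01; rewrite le_eqVlt => /predU1P[a0 _|a0 a1]; last first.
  rewrite level_setE//; split => [/=|x /=].
    by apply: le_trans (conv_ge _ _);
    rewrite le_min (ge_at_level_left hu) ?(ge_at_level_left hv).
  rewrite [_ + _ <= _]leNgt; apply: contraL => /half[e e0 ->]; rewrite -ltNge.
  have ha : 0 < a <= 1 by rewrite a0.
  apply: (@le_lt_trans _ _
    (Num.max (u (level_left u a - e)) (v (level_left v a - e)))).
    have lu : level_left u a - e <= level_left u 1.
      by rewrite lerBlDr ler_wpDr ?(ltW e0)// (le_level_left hu)// ltW.
    have lv : level_left v a - e <= level_left v 1.
      by rewrite lerBlDr ler_wpDr ?(ltW e0)// (le_level_left hv)// ltW.
    by case/andP: (conv_bounds lu lv).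
  by rewrite gt_max (lt_left_of_level hu)// ?(lt_left_of_level hv)//
    ltrBlDr ltrDl.
(* At level 0 one works with closures: points of the two supports within [e / 2] of the endpoints
   add up to a point of the support of [w] within [e] of the sum. Conversely, [w] vanishes left of
   the sum, and a closed half-line absorbs the closure. *)
rewrite -a0 level_set0E in half *.
split.
  move=> B /nbhs_ballP[e /= e0 eB].
  have e20 : 0 < e / 2 by rewrite divr_gt0.
  have h00 : 0 <= (0 : R) <= 1 by rewrite lexx ler01.
  have := level_left_in hu h00; rewrite level_set0E.
  move=> /(_ _ (nbhsx_ballx _ (e / 2) e20))[y [/= uy ye]].
  have := level_left_in hv h00; rewrite level_set0E.
  move=> /(_ _ (nbhsx_ballx _ (e / 2) e20))[z [/= vz ze]].
  exists (y + z); split => /=.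
    by apply: lt_le_trans (conv_ge _ _); rewrite lt_min uy.
  apply: eB; rewrite /ball/= in ye ze *.
  rewrite opprD addrACA (splitr e); apply: le_lt_trans (ler_normD _ _) _.
  exact: ltrD.
move=> x wx; apply: (@closed_ge R); apply: closureS wx => {}x /=.
rewrite [_ + _ <= _]leNgt => wx; apply/negP => /half[e e0 xe].
move: wx; rewrite xe ltNge => /negP; apply; rewrite -a0 in a01 *.
by apply: conv_le => t te; apply: le_left_of_level => //;
  [apply: le_lt_trans te _|apply: lt_trans te _]; rewrite ltrBlDr ltrDl.
Qed.

End convolution.

(** * Difference quotients along a filter, later [0^'-] or [0^'+] *)

Section one_sided_limits.
Context {R : realType}.

Lemma cvg_between {T : Type} {F : set_system T} {FF : Filter F}
    {f g k : T -> R} {l : R} :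
  (\forall x \near F, Num.min (f x) (g x) <= k x <= Num.max (f x) (g x)) ->
  f x @[x --> F] --> l -> g x @[x --> F] --> l -> k x @[x --> F] --> l.
Proof.
move=> fgk /cvgrPdist_lt fl /cvgrPdist_lt gl; apply/cvgrPdist_lt => e e0.
near=> x.
have : `|l - f x| < e by near: x; exact: fl.
have : `|l - g x| < e by near: x; exact: gl.
have : Num.min (f x) (g x) <= k x <= Num.max (f x) (g x) by near: x.
rewrite !ltr_distl ge_min le_max.
move=> /andP[/orP[]h1 /orP[]h2] /andP[? ?] /andP[? ?].
all: by apply/andP; split; lra.
Unshelve. all: by end_near. Qed.

(** The form with [Num.min] and [Num.max] is insensitive to the sign of [h]: a negative divisor
    merely exchanges the two bounds. *)
Lemma between_div (p q r m h : R) :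
  Num.min p q <= r <= Num.max p q ->
  Num.min ((p - m) / h) ((q - m) / h) <= (r - m) / h
    <= Num.max ((p - m) / h) ((q - m) / h).
Proof.
have mono (x y : R) : x <= y ->
    if 0 <= h^-1 then (x - m) / h <= (y - m) / h
    else (y - m) / h <= (x - m) / h.
  move=> xy; case: leP => h0; first by apply: ler_wpM2r; rewrite ?lerD2r.
  by apply: ler_wnM2r; rewrite ?lerD2r// ltW.
rewrite !ge_min !le_max => /andP[/orP[]/mono h1 /orP[]/mono h2].
all: by move: h1 h2; case: ifP => _ -> ->; rewrite ?orbT.
Qed.

Context {F : set_system R} {FF : ProperFilter F}.
Hypothesis F0 : F `=>` 0^'.

(** Differentiability gives continuity along [F]: for nonzero [h], [f (x + h)] is the difference
    quotient times [h], plus [f x]. *)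
Lemma cvg_diffq {f : R -> R} {x l : R} :
  (f (x + h) - f x) / h @[h --> F] --> l -> f (x + h) @[h --> F] --> f x.
Proof.
move=> fl.
have h0 : h @[h --> F] --> (0 : R).
  by apply: cvg_trans F0 _; exact: cvg_within.
have -> : f x = l * 0 + f x by rewrite mulr0 add0r.
apply: cvg_trans (cvgD (cvgM fl h0) (cvg_cst (f x))).
apply: near_eq_cvg.
have : F [set h | h != 0] by apply: F0; exact: nearW.
by apply: filterS => h hn; rewrite !fctE /= divfK// subrK.
Qed.

Hypothesis Fs : forall s : R, 0 < s -> s * h @[h --> F] --> F.

Lemma diffq_scale {f : R -> R} {x l s : R} : 0 < s ->
  (f (x + h) - f x) / h @[h --> F] --> l ->
  (f (x + s * h) - f x) / h @[h --> F] --> s * l.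
Proof.
move=> s0 fl.
apply: cvg_trans (cvgM (cvg_cst s) (cvg_comp _ _ (Fs _ s0) fl)).
apply: near_eq_cvg; near=> h => /=.
rewrite invfM mulrCA [s * (_ * _)]mulrA divff ?gt_eqF// mul1r.
Unshelve. all: by end_near. Qed.

(** Common core of (i) and (ii). Since [u a = v b], the bounds on [w] collapse at [a + b], so all
    three difference quotients subtract the same value. *)
Lemma diffq_conv {u v : R -> R} {a b phi psi : R} :
  fuzzy_number u -> fuzzy_number v ->
  a <= level_left u 1 -> b <= level_left v 1 -> u a = v b ->
  (\forall h \near F, a + h <= level_left u 1) ->
  (\forall h \near F, b + h <= level_left v 1) ->
  0 < phi -> (u (a + h) - u a) / h @[h --> F] --> phi ->
  0 < psi -> (v (b + h) - v b) / h @[h --> F] --> psi ->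
  (sup_min_conv u v (a + b + h) - sup_min_conv u v (a + b)) / h @[h --> F]
    --> (phi^-1 + psi^-1)^-1.
Proof.
move=> hu hv ap bq uv nap nbq phi0 uphi psi0 vpsi.
have wab : sup_min_conv u v (a + b) = u a.
  have := conv_bounds hu hv ap bq.
  by rewrite -uv minxx maxxx -eq_le => /eqP.
have c0 : 0 < (phi^-1 + psi^-1)^-1 by rewrite invr_gt0 addr_gt0// invr_gt0.
set c := (_ + _)^-1 in c0 *.
(* These weights give both scaled quotients the same limit [c]. *)
pose s := c / phi; pose t := c / psi.
have s0 : 0 < s by rewrite divr_gt0.
have t0 : 0 < t by rewrite divr_gt0.
have st : s + t = 1.
  by rewrite -mulrDr mulVf// gt_eqF// -invr_gt0.
have := diffq_scale s0 uphi; rewrite divfK ?gt_eqF// => us.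
have := diffq_scale t0 vpsi; rewrite divfK ?gt_eqF// => vt.
apply: cvg_between us vt.
have nas := Fs _ s0 _ nap; have nbt := Fs _ t0 _ nbq.
near=> h.
rewrite wab -uv; apply: between_div.
have -> : a + b + h = (a + s * h) + (b + t * h).
  by rewrite addrACA -mulrDl st mul1r.
by apply: conv_bounds => //; [near: h; exact: nas|near: h; exact: nbt].
Unshelve. all: by end_near. Qed.

(** Common core of (iii) and (iv): the quotients of [w] and [u] coincide for [h] near [F]. *)
Lemma diffq_conv_eq {u v : R -> R} {a b phi : R} :
  fuzzy_number u -> a <= level_left u 1 -> u a <= v b ->
  (forall t, t < b -> v t <= u a) ->
  (\forall h \near F, [/\ a + h <= level_left u 1, u (a + h) <= v b &
     forall t, t < b -> v t <= u (a + h)]) ->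
  (u (a + h) - u a) / h @[h --> F] --> phi ->
  (sup_min_conv u v (a + b + h) - sup_min_conv u v (a + b)) / h @[h --> F]
    --> phi.
Proof.
move=> hu ap uv vu nh; apply: cvg_trans; apply: near_eq_cvg.
apply: filterS nh => h [hp uvh vuh] /=.
by rewrite (conv_eq hu ap uv vu) addrAC (conv_eq hu hp uvh vuh).
Qed.

End one_sided_limits.

(** * One-sided neighbourhoods and left derivatives at endpoints *)

Lemma at_right_dnbhs {R : realType} (x : R) : x^'+ `=>` x^'.
Proof.
by move=> P; rewrite /at_right /dnbhs /within /=; apply: filterS => y yP xy;
  apply: yP; rewrite gt_eqF.
Qed.

Lemma at_left_dnbhs {R : realType} (x : R) : x^'- `=>` x^'.
Proof.
by move=> P; rewrite /at_left /dnbhs /within /=; apply: filterS => y yP xy;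
  apply: yP; rewrite lt_eqF.
Qed.

Lemma scale_at_right0 {R : realType} (s : R) :
  0 < s -> s * h @[h --> 0^'+] --> 0^'+.
Proof.
move=> s0 P; rewrite /at_right /within /= => nP.
have sc : s * h @[h --> (0 : R)] --> (0 : R).
  rewrite -[X in _ --> X](mulr0 s).
  by apply: cvgM; [exact: cvg_cst|exact: cvg_id].
have : \forall h \near (0 : R), 0 < s * h -> P (s * h) by exact: (sc _ nP).
by apply: filterS => h hP h0; apply: hP; rewrite mulr_gt0.
Qed.

Lemma scale_at_left0 {R : realType} (s : R) :
  0 < s -> s * h @[h --> 0^'-] --> 0^'-.
Proof.
move=> s0 P; rewrite /at_left /within /= => nP.
have sc : s * h @[h --> (0 : R)] --> (0 : R).
  rewrite -[X in _ --> X](mulr0 s).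
  by apply: cvgM; [exact: cvg_cst|exact: cvg_id].
have : \forall h \near (0 : R), s * h < 0 -> P (s * h) by exact: (sc _ nP).
by apply: filterS => h hP h0; apply: hP; rewrite pmulr_rlt0.
Qed.

(** Values left of the endpoint are at most [a] and the value there is at least [a]; the left
    continuity given by the derivative excludes a jump. *)
Lemma left_derivative_at_level {R : realType} {u : R -> R} {a l : R} :
  fuzzy_number u -> 0 <= a <= 1 ->
  is_left_derivative u (level_left u a) l -> u (level_left u a) = a.
Proof.
move=> hu a01 /(cvg_diffq (at_left_dnbhs _)) ul; apply/eqP.
rewrite eq_le (ge_at_level_left hu a01) andbT; apply: (cvgr_to_le ul).
near=> h; apply: (le_left_of_level hu) => //; rewrite gtrDl.
by near: h; exact: nbhs_left_lt.
Unshelve. all: by end_near. Qed.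

Theorem theorem4p2 (R : realType) (u v : R -> R) (alpha : R)
    (hu : fuzzy_number u) (hv : fuzzy_number v) (halpha : 0 <= alpha <= 1) :
  [/\ (* (i) *)
      forall phi psi : R,
        is_left_derivative u (level_left u alpha) phi -> 0 < phi ->
        is_left_derivative v (level_left v alpha) psi -> 0 < psi ->
        is_left_derivative (sup_min_conv u v)
          (level_left (sup_min_conv u v) alpha) (phi^-1 + psi^-1)^-1,
      (* (ii) *)
      forall phi psi beta : R,
        is_right_derivative u (level_left u alpha) phi -> 0 < phi ->
        is_right_derivative v (level_left v alpha) psi -> 0 < psi ->
        u (level_left u alpha) = beta -> v (level_left v alpha) = beta ->
        is_right_derivative (sup_min_conv u v)
          (level_left (sup_min_conv u v) beta) (phi^-1 + psi^-1)^-1,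
      (* (iii) *)
      forall phi beta gamma : R,
        is_right_derivative u (level_left u alpha) phi ->
        u (level_left u alpha) = beta ->
        v (level_left v alpha) = gamma -> beta < gamma ->
        is_right_derivative (sup_min_conv u v)
          (level_left (sup_min_conv u v) beta) phi &
      (* (iv) *)
      forall phi lambda : R,
        is_left_derivative u (level_left u alpha) phi ->
        v y @[y --> (level_left v alpha)^'-] --> lambda -> lambda < alpha ->
        is_left_derivative (sup_min_conv u v)
          (level_left (sup_min_conv u v) alpha) phi].
Proof.
have [a0 a1] := andP halpha.
have h1 : (1 : R) <= 1 by [].
have ap := le_level_left hu a0 a1 h1; have bq := le_level_left hv a0 a1 h1.
have ua := ge_at_level_left hu halpha; have va := ge_at_level_left hv halpha.
have left_near (c p : R) : c <= p -> \forall h \near 0^'-, c + h <= p.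
  move=> cp; near=> h; rewrite (le_trans _ cp)// gerDl.
  by near: h; exact: nbhs_left_le.
have right_near (c p : R) : c < p -> \forall h \near 0^'+, c + h <= p.
  move=> cp; near=> h; rewrite addrC -lerBrDr.
  by near: h; apply: nbhs_right_le; rewrite subr_gt0.
split.
- move=> phi psi uphi phi0 vpsi psi0.
  rewrite level_left_conv//.
  apply: (diffq_conv scale_at_left0) => //; try exact: left_near.
  by rewrite (left_derivative_at_level hu halpha uphi)
             (left_derivative_at_level hv halpha vpsi).
- move=> phi psi beta uphi phi0 vpsi psi0 ub vb.
  have b01 : 0 <= beta <= 1 by rewrite -ub (fuzzy_ge0 _ hu) (fuzzy_le1 _ hu).
  (* At the maximal value 1 all right quotients would be nonpositive. So the endpoint lies strictly
     left of the core, and small steps to the right stay on the increasing branch. *)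
  have lt1 (f : R -> R) (l : R) : fuzzy_number f -> 0 < l ->
      is_right_derivative f (level_left f alpha) l ->
      f (level_left f alpha) < 1.
    move=> hf l0 fl; rewrite ltNge; apply/negP => f1; move: l0.
    rewrite ltNge => /negP; apply; apply: (cvgr_to_le fl); near=> h.
    have h0 : 0 < h by near: h; exact: nbhs_right_gt.
    by rewrite ler_pdivrMr// mul0r subr_le0 (le_trans _ f1)// fuzzy_le1.
  rewrite level_left_conv//.
  have ab : alpha <= beta by rewrite -ub.
  rewrite (level_left_const hu a0 ab) ?ub// (level_left_const hv a0 ab) ?vb//.
  apply: (diffq_conv scale_at_right0) => //; rewrite ?ub ?vb//.
    by apply: right_near; apply: lt_level_left1 => //; exact: lt1 uphi.
  by apply: right_near; apply: lt_level_left1 => //; exact: lt1 vpsi.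
- move=> phi beta gamma uphi ub vg bg.
  have ab : alpha <= beta by rewrite -ub.
  have b01 : 0 <= beta <= 1 by rewrite -ub (fuzzy_ge0 _ hu) (fuzzy_le1 _ hu).
  have g1 : gamma <= 1 by rewrite -vg fuzzy_le1.
  rewrite level_left_conv//.
  rewrite (level_left_const hu a0 ab) ?ub//.
  rewrite (level_left_const hv a0 ab) ?vg ?ltW//.
  have vu t : t < level_left v alpha -> v t <= beta.
    by move=> /(le_left_of_level hv halpha)/le_trans; apply.
  apply: diffq_conv_eq (uphi) => //; rewrite ?ub ?vg ?ltW//.
  (* Here the room on the right comes from [beta < gamma <= 1], not from the sign of [phi]. *)
  have ap' : level_left u alpha < level_left u 1.
    by apply: lt_level_left1 => //; rewrite ub (lt_le_trans bg).
  have ucvg : u (level_left u alpha + h) @[h --> 0^'+] --> beta.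
    by rewrite -[X in _ --> X]ub; exact: (cvg_diffq (at_right_dnbhs _) uphi).
  near=> h.
  have hp : level_left u alpha + h <= level_left u 1.
    by near: h; exact: right_near.
  split => //.
    by near: h; exact: (cvgr_le _ ucvg _ bg).
  move=> t /vu/le_trans; apply; rewrite -ub.
  apply: left_branch_mono => //; rewrite lerDl.
  by near: h; exact: nbhs_right_ge.
- move=> phi lambda uphi vl la.
  have ub := left_derivative_at_level hu halpha uphi.
  rewrite level_left_conv//.
  apply: diffq_conv_eq (uphi) => //; rewrite ?ub//.
    by move=> t; exact: le_left_of_level.
  have ucvg : u (level_left u alpha + h) @[h --> 0^'-] --> alpha.
    by rewrite -[X in _ --> X]ub; exact: (cvg_diffq (at_left_dnbhs _) uphi).
  near=> h.
  have h0 : h < 0 by near: h; exact: nbhs_left_lt.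
  split => //.
  + by near: h; exact: left_near.
  + apply: le_trans va; apply: le_left_of_level => //.
    by rewrite gtrDl.
  (* By monotonicity the left limit [lambda] bounds [v t] from above, while [u] at the shifted point
     tends to [alpha > lambda]. *)
  + move=> t tb; apply: (@le_trans _ _ lambda).
      apply: (cvgr_to_ge vl); near=> y; apply: left_branch_mono => //.
        by near: y; exact: nbhs_left_ge.
      by apply: le_trans bq; near: y; exact: nbhs_left_le.
    by near: h; exact: (cvgr_ge _ ucvg _ la).
Unshelve. all: by end_near. Qed.
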